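(* Let $n\in\mathbb{Z}_+$ and let $\mathcal{P}$ be the verbose persistence diagram of the infinite random lower triangular matrix $L$ over $\mathbb{F}_q$. (a) With probability $1$, the set $\mathcal{P}\cap [1,n]^2$ is admissible. (b) For any admissible set $S\subset \overline{\Delta}_{\mathbb{Z}}\cap [1,n]^2$, we have \[\mathbb{P}(\mathcal{P}\cap [1,n]^2=S)=\left(\frac{q-1}{q}\right)^{|S|}q^{\Sigma(S)+\operatorname{inv}(S)-\binom{n+1}{2}}.\]
   Context: Setting. Fix a prime power $q$. Let $(L(i,j))_{1\le j\le i}$ ($i,j\in\mathbb{Z}_+=\{1,2,\dots\}$) be i.i.d. uniform random elements of $\mathbb{F}_q$, and let $L(i,j)=0$ for $1\le i<j$; $L=(L(i,j))_{i,j\in\mathbb{Z}_+}$. Let $\mathbb{F}_q^{\mathbb{Z}_+}$ denote the space of row vectors indexed by $\mathbb{Z}_+$ with only finitely many nonzero components. Let $Z_n=\{v\in\mathbb{F}_q^{\mathbb{Z}_+} : v_i=0\text{ for all }i>n\}$ and let $B_n=\{vL : v\in Z_n\}$ be the span of the first $n$ rows of $L$. For nonzero $v\in\mathbb{F}_q^{\mathbb{Z}_+}$ let $b(v)=\min\{i : v\in Z_i\}$ and $d(v)=\min\{i: v\in B_i\}$. Verbose persistence diagram. Let $\overline{\Delta}_{\mathbb{Z}}=\{(b,d)\in\mathbb{Z}_+^2 : b\le d\}$. With probability $1$ there is a unique subset $\mathcal{P}\subset\overline{\Delta}_{\mathbb{Z}}$ for which there is a basis $(v_p)_{p\in\mathcal{P}}$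 of $\mathbb{F}_q^{\mathbb{Z}_+}$ such that $b(v_p)=b$, $d(v_p)=d$ for every $p=(b,d)\in\mathcal{P}$; for all $r,s\in\mathbb{Z}_+$ the vectors $\{v_p : p\in\mathcal{P}\cap([1,r]\times[1,s])\}$ form a basis of $Z_r\cap B_s$; and for all $r$ the vectors $\{v_p : p\in\mathcal{P}\cap([1,r]\times[1,\infty))\}$ form a basis of $Z_r$. This $\mathcal{P}$ is the verbose persistence diagram; it is characterized by $\dim (Z_r\cap B_s)=|\mathcal{P}\cap([1,r]\times[1,s])|$ for all $r,s\in\mathbb{Z}_+$. Admissibility. A set $S\subset \overline{\Delta}_{\mathbb{Z}}\cap [1,n]^2$ is admissible if for every $b\in\{1,\dots,n\}$ there is at most one $d$ with $(b,d)\in S$, and for every $d\in\{1,\dots,n\}$ there is at most one $b$ with $(b,d)\in S$. For admissible $S$ and $i\in\{1,\dots,n\}$, $b_i(S)$ is the unique $b$ with $(b,i)\in S$ if such a $b$ exists, and $b_i(S)=-\infty$ otherwise. The inversion number is $\operatorname{inv}(S)=|\{(i,j)\in\{1,\dots,n\}^2 : i<j,\ b_i(S)>b_j(S)\}|$ (here $b>-\infty$ for every integer $b$, and $-\infty\not>-\infty$). Finally $\Sigma(S)=\sum_{(b,d)\in S} b$. *)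

(* Defs.v *)
From HB Require Import structures.
From mathcomp Require Import all_boot all_order all_algebra finmap.
From mathcomp Require Import all_classical all_reals all_analysis.

Set Implicit Arguments.
Unset Strict Implicit.
Unset Printing Implicit Defensive.

Import Order.TTheory GRing.Theory Num.Theory.
Local Open Scope classical_set_scope.
Local Open Scope ring_scope.

(* All indices are 1-based, as in Z_+ = {1, 2, ...}.  A finitely supported row
   vector (v_1, v_2, ...) over F is encoded by the polynomial whose coefficient
   of 'X^k is v_(k+1); only the vector space structure of {poly F} is used. *)

Definition segment (n : nat) : set nat := [set k | (1 <= k <= n)%N].
Definition positive : set nat := [set k | (1 <= k)%N].

Definition is_least (A : set nat) (m : nat) : Prop :=
  A m /\ forall k, A k -> (m <= k)%N.

Section Filtrations.
Variable F : fieldType.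

Definition vcoord (v : {poly F}) (i : nat) : F := v`_i.-1.

(* For a lower triangular M this is the whole row M(i, 1), M(i, 2), ... *)
Definition row_vec (M : nat -> nat -> F) (i : nat) : {poly F} :=
  \poly_(k < i) M i k.+1.

(* The product v M; the coordinates v_i with i > size v vanish. *)
Definition vec_mul (v : {poly F}) (M : nat -> nat -> F) : {poly F} :=
  \sum_(1 <= i < (size v).+1) vcoord v i *: row_vec M i.

Definition Zsp (n : nat) : set {poly F} :=
  [set v | forall i, (n < i)%N -> vcoord v i = 0].

Definition Bsp (M : nat -> nat -> F) (n : nat) : set {poly F} :=
  (fun v => vec_mul v M) @` Zsp n.

Definition birth (v : {poly F}) (b : nat) : Prop :=
  is_least [set i | (1 <= i)%N /\ Zsp i v] b.

Definition death (M : nat -> nat -> F) (v : {poly F}) (d : nat) : Prop :=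
  is_least [set i | (1 <= i)%N /\ Bsp M i v] d.

(* The family (v_p), p in A, is a basis of the subspace U. *)
Definition is_basis (U : set {poly F}) (A : set (nat * nat))
    (v : nat * nat -> {poly F}) : Prop :=
  [/\ forall p, A p -> U (v p),
      forall (s : seq (nat * nat)) (c : nat * nat -> F),
        uniq s -> (forall p, p \in s -> A p) ->
        \sum_(p <- s) c p *: v p = 0 -> forall p, p \in s -> c p = 0
    & forall u, U u -> exists (s : seq (nat * nat)) (c : nat * nat -> F),
        (forall p, p \in s -> A p) /\ u = \sum_(p <- s) c p *: v p].

Definition Delta : set (nat * nat) := [set p | (1 <= p.1 <= p.2)%N].

Definition is_verbose_diagram (M : nat -> nat -> F) (D : set (nat * nat)) :
    Prop :=
  D `<=` Delta /\
  exists v : nat * nat -> {poly F},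
    [/\ is_basis setT D v,
        forall p, D p -> birth (v p) p.1 /\ death M (v p) p.2,
        forall r s, (1 <= r)%N -> (1 <= s)%N ->
          is_basis (Zsp r `&` Bsp M s) (D `&` (segment r `*` segment s)) v
      & forall r, (1 <= r)%N ->
          is_basis (Zsp r) (D `&` (segment r `*` positive)) v].

(* The default value set0 is taken only if M has no verbose diagram. *)
Definition verbose_diagram (M : nat -> nat -> F) : set (nat * nat) :=
  xget set0 (is_verbose_diagram M).

End Filtrations.

Definition square (n : nat) : set (nat * nat) := segment n `*` segment n.

Definition admissible (n : nat) (S : set (nat * nat)) : Prop :=
  [/\ S `<=` Delta `&` square n,
      forall b d d', S (b, d) -> S (b, d') -> d = d'
    & forall b b' d, S (b, d) -> S (b', d) -> b = b'].

Definition birth_at (S : {fset nat * nat}) (i : nat) : \bar int :=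
  if [seq p.1 | p <- S & p.2 == i] is b :: _ then (b%:Z)%:E else -oo%E.

(* Elements of 'I_n are 0-based, hence the successors. *)
Definition inversions (n : nat) (S : {fset nat * nat}) : nat :=
  #|[set ij : 'I_n * 'I_n | (ij.1 < ij.2)%N &&
       (birth_at S ij.2.+1 < birth_at S ij.1.+1)%E]%SET|.

Definition Sigma (S : {fset nat * nat}) : nat := (\sum_(p <- S) p.1)%N.

(* Every subset of the finite field F is regarded as measurable. *)
Record iid_uniform_lower_triangular (d : measure_display)
    (T : measurableType d) (R : realType) (P : probability T R)
    (F : finFieldType) (L : nat -> nat -> T -> F) : Prop := {
  entry_measurable : forall i j, (1 <= j <= i)%N ->
    forall A : set F, measurable (L i j @^-1` A);
  entry_uniform : forall i j, (1 <= j <= i)%N ->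
    forall a : F, P (L i j @^-1` [set a]) = ((#|F|%:R : R)^-1)%:E;
  entries_independent : forall (J : {fset nat * nat}) (A : nat * nat -> set F),
    (forall p, p \in J -> (1 <= p.2 <= p.1)%N) ->
    P (\bigcap_(p in [set` J]) (L p.1 p.2 @^-1` A p)) =
    (\prod_(p <- J) P (L p.1 p.2 @^-1` A p))%E;
  entry_upper : forall i j, (1 <= i < j)%N -> forall w, L i j w = 0
}.

(* Main.v *)
(** For fixed s the spaces Z_b + B_s increase with b; let beta(s+1) be the least
    b such that row s + 1 of L lies in Z_b + B_s.  Subtracting from row s + 1 a
    suitable element of B_s yields a vector of Z_beta(s+1); the nonzero vectors so
    obtained form a basis compatible with both filtrations as soon as every unit
    vector lies in some B_s, so the diagram is {(beta(d), d) : beta(d) > 0}.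

    Given the first s rows, beta(s+1) <= b means that a uniform vector of Z_(s+1)
    falls in Z_b + B_s, a space of dimension b + #{i <= s : beta(i) > b}.
    Multiplying these conditional probabilities over s < n gives the formula.

    A fixed vector e almost surely enters some B_s: let c_s = s - dim B_s and
    let 1_s indicate that e is not in B_s.  For large s, E[1_s q^(c_s)] is constant,
    and P(e notin B_s) drops by (q - 1)/q E[1_s q^(-c_s)] at step s, which by the
    inequality of Cauchy-Schwarz is at least a constant times P(e notin B_s)^2;
    hence P(e notin B_s) tends to 0. *)

Require Import Defs.
From HB Require Import structures.
From mathcomp Require Import all_boot all_order all_algebra finmap.
From mathcomp Require Import all_classical all_reals all_analysis.
From mathcomp Require Import zify ring lra.

Set Implicit Arguments.
Unset Strict Implicit.
Unset Printing Implicit Defensive.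

Import Order.TTheory GRing.Theory Num.Theory.
Local Open Scope classical_set_scope.
Local Open Scope ring_scope.

(** * Row spaces and births *)

Section Subspaces.
Variable F : fieldType.
Implicit Types (M : nat -> nat -> F) (u v y : {poly F}).

Definition linear_set (V : set {poly F}) : Prop :=
  V 0 /\ forall a u v, V u -> V v -> V (a *: u + v).

Lemma linear_setD V u v : linear_set V -> V u -> V v -> V (u + v).
Proof. by move=> [_ lin] Vu Vv; have := lin 1 _ _ Vu Vv; rewrite scale1r. Qed.

Lemma linear_setZ V a u : linear_set V -> V u -> V (a *: u).
Proof. by move=> [V0 lin] Vu; have := lin a _ _ Vu V0; rewrite addr0. Qed.

Lemma linear_setB V u v : linear_set V -> V u -> V v -> V (u - v).
Proof.
by move=> sV Vu Vv; rewrite -scaleN1r; apply: linear_setD => //; apply: linear_setZ.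
Qed.

Lemma linear_set_sum V (I : eqType) (r : seq I) (Q : pred I) (f : I -> {poly F}) :
  linear_set V -> (forall i, i \in r -> Q i -> V (f i)) ->
  V (\sum_(i <- r | Q i) f i).
Proof.
move=> sV Vf; rewrite big_seq_cond.
apply: (big_ind V); first by case: sV.
- by move=> u v; apply: linear_setD.
- by move=> i /andP[ir Qi]; apply: Vf.
Qed.

Lemma linear_set_cancel V a u v :
  linear_set V -> a != 0 -> V v -> V (a *: u + v) -> V u.
Proof.
move=> sV a0 Vv Vuv.
have := linear_setZ a^-1 sV (linear_setB sV Vuv Vv).
by rewrite addrK scalerA mulVf// scale1r.
Qed.

Lemma ZspE n u : Zsp n u <-> (size u <= n)%N.
Proof.
split=> [Zu|/leq_sizeP Zu i ni]; last by apply: Zu; lia.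
by apply/leq_sizeP => j nj; apply: (Zu j.+1).
Qed.

Lemma linear_set_Zsp n : linear_set (@Zsp F n).
Proof.
split=> [i _|a u v Zu Zv i ni]; first by rewrite /vcoord coef0.
by rewrite /vcoord coefD coefZ [u`__]Zu// [v`__]Zv// mulr0 addr0.
Qed.

Lemma Zsp_le m n u : (m <= n)%N -> Zsp m u -> Zsp n u.
Proof. by move=> mn Zu i ni; apply: Zu; lia. Qed.

Lemma Zsp0 u : Zsp 0 u -> u = 0.
Proof. by move/ZspE; rewrite leqn0 size_poly_eq0 => /eqP. Qed.

Lemma vec_mulE M s v : (size v <= s)%N ->
  vec_mul v M = \sum_(i < s) v`_i *: row_vec M i.+1.
Proof.
move=> vs; rewrite /vec_mul big_add1 /=.
rewrite -(big_mkord xpredT (fun i => v`_i *: row_vec M i.+1)).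
rewrite [RHS](big_cat_nat (n := size v))//= [X in _ = _ + X]big1_seq ?addr0//.
by move=> i /=; rewrite mem_index_iota => /andP[vi _]; rewrite nth_default ?scale0r.
Qed.

Lemma BspE M s u :
  Bsp M s u <-> exists c : nat -> F, u = \sum_(i < s) c i *: row_vec M i.+1.
Proof.
split=> [[v /ZspE vs <-]|[c ->]].
  by exists (nth 0 v); rewrite (vec_mulE _ vs).
exists (\poly_(i < s) c i); first by apply/ZspE/size_poly.
rewrite (vec_mulE _ (size_poly _ _)); apply: eq_bigr => i _.
by rewrite coef_poly ltn_ord.
Qed.

Lemma linear_set_Bsp M s : linear_set (Bsp M s).
Proof.
split=> [|a u v /BspE[c ->] /BspE[c' ->]]; apply/BspE.
  by exists (fun=> 0); rewrite big1// => i _; rewrite scale0r.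
exists (fun i => a * c i + c' i); rewrite scaler_sumr -big_split/=.
by apply: eq_bigr => i _; rewrite scalerDl scalerA.
Qed.

Lemma Bsp0 M u : Bsp M 0 u -> u = 0.
Proof. by move=> /BspE[c ->]; rewrite big_ord0. Qed.

Lemma BspS M s u :
  Bsp M s.+1 u <-> exists a, Bsp M s (u - a *: row_vec M s.+1).
Proof.
split=> [/BspE[c ->]|[a /BspE[c uE]]].
  by exists (c s); apply/BspE; exists c; rewrite big_ord_recr/= addrK.
apply/BspE; exists (fun i => if i == s then a else c i).
rewrite big_ord_recr/= eqxx -[LHS](subrK (a *: row_vec M s.+1)) uE.
by congr (_ + _); apply: eq_bigr => i _; rewrite ltn_eqF.
Qed.

Lemma Bsp_le M m n u : (m <= n)%N -> Bsp M m u -> Bsp M n u.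
Proof.
move=> /subnK <-; elim: (n - m)%N => [//|k IH] Bu.
by rewrite addSn; apply/BspS; exists 0; rewrite scale0r subr0; apply: IH.
Qed.

Lemma Bsp_row M s : Bsp M s.+1 (row_vec M s.+1).
Proof.
by apply/BspS; exists 1; rewrite scale1r subrr; case: (linear_set_Bsp M s).
Qed.

(** The sum $Z_b + B_s$, written through its summand in $B_s$. *)
Definition ZBsp M (b s : nat) : set {poly F} :=
  [set u | exists2 y, Bsp M s y & Zsp b (u - y)].

Lemma linear_set_ZBsp M b s : linear_set (ZBsp M b s).
Proof.
have [sZ sB] := (linear_set_Zsp b, linear_set_Bsp M s).
split=> [|a u v [y By Zy] [z Bz Zz]].
  by exists 0; rewrite ?subr0; [case: sB|case: sZ].
exists (a *: y + z); first by case: sB => _; apply.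
by rewrite opprD addrACA -scalerBr; case: sZ => _; apply.
Qed.

Lemma ZBsp_le M b b' s u : (b <= b')%N -> ZBsp M b s u -> ZBsp M b' s u.
Proof. by move=> bb' [y By Zy]; exists y => //; apply: Zsp_le Zy. Qed.

Lemma ZBsp0 M s : ZBsp M 0 s = Bsp M s.
Proof.
apply/seteqP; split=> u; last first.
  by move=> Bu; exists u => //; rewrite subrr; case: (linear_set_Zsp 0).
by move=> [y By /Zsp0/eqP]; rewrite subr_eq0 => /eqP ->.
Qed.

Lemma ZBspS M b s u :
  ZBsp M b s.+1 u <-> exists a, ZBsp M b s (u - a *: row_vec M s.+1).
Proof.
split=> [[y /BspS[a By] Zy]|[a [y By Zy]]].
  by exists a, (y - a *: row_vec M s.+1) => //; rewrite opprB addrA subrK.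
exists (y + a *: row_vec M s.+1); last by rewrite opprD addrA addrAC.
by apply/BspS; exists a; rewrite addrK.
Qed.

Lemma ZBsp_row M s : exists b, `[< ZBsp M b s (row_vec M s.+1) >].
Proof.
exists s.+1; apply/asboolP; exists 0; first by case: (linear_set_Bsp M s).
by rewrite subr0; apply/ZspE/size_poly.
Qed.

(* The index s + 1 of a row is the death coordinate d, and beta M s is the birth
   coordinate b_d; the value 0 stands for - oo. *)
Definition beta M s : nat := ex_minn (ZBsp_row M s).

Lemma beta_leE M s b : (beta M s <= b)%N <-> ZBsp M b s (row_vec M s.+1).
Proof.
rewrite /beta; case: ex_minnP => m /asboolP Wm minm; split=> [mb|Wb].
  exact: ZBsp_le Wm.
by apply/minm/asboolP.
Qed.

Lemma beta_le M s : (beta M s <= s.+1)%N.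
Proof.
apply/beta_leE; exists 0; first by case: (linear_set_Bsp M s).
by rewrite subr0; apply/ZspE/size_poly.
Qed.

Lemma eq_row M M' s :
  (forall i j, (1 <= j <= i)%N -> (i <= s)%N -> M i j = M' i j) ->
  forall i, (i <= s)%N -> row_vec M i = row_vec M' i.
Proof.
move=> MM' i ilt; apply/polyP => k; rewrite !coef_poly.
by case: ltnP => // ki; apply: MM'; lia.
Qed.

Lemma eq_Bsp M M' s : (forall i, (i <= s)%N -> row_vec M i = row_vec M' i) ->
  Bsp M s = Bsp M' s.
Proof.
move=> MM'; apply/seteqP; split=> u /BspE[c ->]; apply/BspE; exists c;
  by apply: eq_bigr => i _; rewrite MM'.
Qed.

Lemma eq_ZBsp M M' b s : (forall i, (i <= s)%N -> row_vec M i = row_vec M' i) ->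
  ZBsp M b s = ZBsp M' b s.
Proof. by move=> MM'; rewrite /ZBsp (eq_Bsp MM'). Qed.

Lemma eq_beta M M' s : (forall i, (i <= s.+1)%N -> row_vec M i = row_vec M' i) ->
  beta M s = beta M' s.
Proof.
move=> MM'; have MM's i : (i <= s)%N -> row_vec M i = row_vec M' i.
  by move=> /leqW; apply: MM'.
apply/eqP; rewrite eqn_leq; apply/andP; split; apply/beta_leE.
- by rewrite (eq_ZBsp _ MM's) MM'//; apply/beta_leE.
- by rewrite -(eq_ZBsp _ MM's) -MM'//; apply/beta_leE.
Qed.

Lemma reducedP M s : exists v, Zsp (beta M s) v /\ Bsp M s (row_vec M s.+1 - v).
Proof.
have /beta_leE[y By Zy] := leqnn (beta M s).
by exists (row_vec M s.+1 - y); split=> //; rewrite opprB addrC subrK.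
Qed.

(** Row [s.+1] reduced by the earlier rows as far as possible; it vanishes exactly when that row
    lies in $B_s$. *)
Definition reduced M s : {poly F} := projT1 (cid (reducedP M s)).

Lemma Zsp_reduced M s : Zsp (beta M s) (reduced M s).
Proof. by rewrite /reduced; case: cid => v /= []. Qed.

Lemma row_reduced M s : Bsp M s (row_vec M s.+1 - reduced M s).
Proof. by rewrite /reduced; case: cid => v /= []. Qed.

Lemma Bsp_reduced M s : Bsp M s.+1 (reduced M s).
Proof.
have sB := linear_set_Bsp M s.+1.
have := linear_setB sB (Bsp_row M s) (Bsp_le (leqnSn s) (row_reduced M s)).
by rewrite opprB addrC subrK.
Qed.

(** The reduced vector and its row differ by an element of $B_s$, so the minimality of [beta] passes
    to the reduced vector. *)
Lemma ZBsp_reduced M b s : ZBsp M b s (reduced M s) -> (beta M s <= b)%N.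
Proof.
move=> Wv; apply/beta_leE.
rewrite -[row_vec _ _](subrK (reduced M s)); apply: linear_setD => //.
- exact: linear_set_ZBsp.
- by apply: (@ZBsp_le M 0) => //; rewrite ZBsp0; apply: row_reduced.
Qed.

Lemma Zsp_ZBsp M b s u : Zsp b u -> ZBsp M b s u.
Proof. by exists 0; rewrite ?subr0//; case: (linear_set_Bsp M s). Qed.

Lemma Bsp_ZBsp M b s u : Bsp M s u -> ZBsp M b s u.
Proof. by exists u => //; rewrite subrr; case: (linear_set_Zsp b). Qed.

(** If two reduced vectors had the same birth $b > 0$, a multiple of the earlier one, which lies in
    $B_{s+1} \subseteq B_{s'}$, would cancel position $b$ of the later one and contradict the
    minimality of its [beta]. *)
Lemma beta_inj M s s' : (0 < beta M s)%N -> beta M s = beta M s' -> s = s'.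
Proof.
wlog ss' : s s' / (s < s')%N.
  move=> wl b0 bE; case: (ssrnat.ltngtP s s') => // ss'; first exact: wl.
  by apply/esym/wl; rewrite -?bE.
set b := beta M s => b0 bE; exfalso.
set x := (reduced M s)`_b.-1; set a := (reduced M s')`_b.-1 / x.
have ZP u : Zsp b u -> u`_b.-1 = 0 -> Zsp b.-1 u.
  move=> Zu u0 i bi; have [->|nib] := eqVneq i b; first exact: u0.
  by apply: Zu; lia.
have x0 : x != 0.
  apply/eqP => x0; suff : (b <= b.-1)%N by lia.
  by apply: ZBsp_reduced; apply: Zsp_ZBsp; apply: ZP => //; apply: Zsp_reduced.
suff : (beta M s' <= b.-1)%N by rewrite -bE; lia.
apply: ZBsp_reduced.
rewrite -[reduced M s'](subrK (a *: reduced M s)); apply: linear_setD.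
- exact: linear_set_ZBsp.
- apply: Zsp_ZBsp; apply: ZP; last by rewrite coefB coefZ /a mulfVK// subrr.
  have sZ := linear_set_Zsp b; apply: (linear_setB sZ); last first.
    by apply: (linear_setZ _ sZ); apply: Zsp_reduced.
  by rewrite bE; apply: Zsp_reduced.
- apply: (linear_setZ _ (linear_set_ZBsp _ _ _)).
  by apply: Bsp_ZBsp; apply: (@Bsp_le M s.+1) => //; apply: Bsp_reduced.
Qed.

End Subspaces.

(** * The verbose diagram of a matrix *)

Section Diagram.
Variable F : fieldType.
Implicit Types (M : nat -> nat -> F) (u v y : {poly F}) (p : nat * nat).

(** This is exactly the condition for a verbose diagram to exist, by [beta_diagramP] and
    [verbose_diagram_exhaustive]. *)
Definition exhaustive M : Prop := forall k, exists s, Bsp M s 'X^k.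

Lemma exhaustiveP M : exhaustive M -> forall u, exists s, Bsp M s u.
Proof.
move=> exM u.
have [s sP] : exists s, forall k, (k < size u)%N -> Bsp M s 'X^k.
  elim: (size u) => [|n [s sP]]; first by exists 0.
  have [t tP] := exM n; exists (maxn s t) => k.
  rewrite ltnS leq_eqVlt => /predU1P[->|kn].
    exact: Bsp_le (leq_maxr _ _) tP.
  exact: Bsp_le (leq_maxl _ _) (sP _ kn).
exists s; rewrite -[u]coefK poly_def.
apply: linear_set_sum; first exact: linear_set_Bsp.
by move=> i _ _; apply: (linear_setZ _ (linear_set_Bsp _ _)); apply: sP.
Qed.

(** The condition [0 < p.2] matters because [0.-1] is [0]: it keeps the first row from being listed
    with death [0] as well. *)
Definition beta_diagram M : set (nat * nat) :=
  [set p | (0 < p.1)%N /\ (0 < p.2)%N /\ p.1 = beta M p.2.-1].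

Definition reduced_at M p : {poly F} := reduced M p.2.-1.

(** Induction on [s]: a vector of $Z_r \cap B_{s+1}$ outside $B_s$ forces row $s+1$ into $Z_r +
    B_s$, so the birth is at most $r$ and subtracting the right multiple of the reduced vector lands
    in $Z_r \cap B_s$. *)
Lemma beta_diagram_span M s r u : Bsp M s u -> Zsp r u ->
  exists (l : seq (nat * nat)) (c : nat * nat -> F),
    (forall p, p \in l -> beta_diagram M p /\ (p.1 <= r)%N /\ (p.2 <= s)%N) /\
    u = \sum_(p <- l) c p *: reduced_at M p.
Proof.
elim: s u => [|s IH] u Bu Zu.
  by exists [::], (fun=> 0); split=> //; rewrite big_nil; apply: Bsp0 Bu.
have {}IH y : Bsp M s y -> Zsp r y ->
    exists (l : seq (nat * nat)) (c : nat * nat -> F),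
    (forall p, p \in l -> beta_diagram M p /\ (p.1 <= r)%N /\ (p.2 <= s.+1)%N) /\
    (forall p, p \in l -> (p.2 <= s)%N) /\
    y = \sum_(p <- l) c p *: reduced_at M p.
  move=> By Zy; have [l [c [lP yE]]] := IH y By Zy.
  by exists l, c; split=> [p|]; [|split=> // p] => /lP [? []] //; split=> //; lia.
have [a Ba] := (BspS M s u).1 Bu.
set y := u - a *: reduced M s.
have By : Bsp M s y.
  rewrite (_ : y = a *: (row_vec M s.+1 - reduced M s) + (u - a *: row_vec M s.+1)).
    by case: (linear_set_Bsp M s) => _; apply => //; apply: row_reduced.
  by rewrite scalerBr [RHS]addrC addrA subrK.
have [a0|a0] := eqVneq (a *: reduced M s) 0.
  rewrite /y a0 subr0 in By.
  by have [l [c [lP [_ uE]]]] := IH u By Zu; exists l, c.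
have br : (beta M s <= r)%N.
  apply/beta_leE; apply: (linear_set_cancel (linear_set_ZBsp M r s) (a := a)).
  - by apply: contraNneq a0 => ->; rewrite scale0r.
  - exact: Bsp_ZBsp Ba.
  - by rewrite addrC subrK; apply: Zsp_ZBsp.
have Zy : Zsp r y.
  apply: (linear_setB (linear_set_Zsp F r)) => //.
  by apply: (linear_setZ _ (linear_set_Zsp F r)); apply: Zsp_le br (@Zsp_reduced _ M s).
have [l [c [lP [ls yE]]]] := IH y By Zy.
exists ((beta M s, s.+1) :: l), (fun p => if p.2 == s.+1 then a else c p); split.
  move=> p; rewrite inE => /predU1P[->|/lP//]; split; last by [].
  split=> //=; rewrite lt0n; apply: contraNneq a0 => b0.
  by have := @Zsp_reduced _ M s; rewrite b0 => /Zsp0 ->; rewrite scaler0.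
rewrite big_cons eqxx addrC -[LHS](subrK (a *: reduced M s)) -/y yE.
congr (_ + _); apply: eq_big_seq => p /ls ps.
by rewrite ifF//; apply/negbTE; rewrite neq_ltn ltnS ps.
Qed.

Lemma beta_diagram_Bsp M p : beta_diagram M p -> Bsp M p.2 (reduced_at M p).
Proof. by case: p => b [|s] [/= _ [//]] _ _; apply: Bsp_reduced. Qed.

Lemma beta_diagram_Zsp M p : beta_diagram M p -> Zsp p.1 (reduced_at M p).
Proof. by move=> [_ [_ ->]]; apply: Zsp_reduced. Qed.

(** Membership in $B_s = Z_0 + B_s$ for some $s$ below the death would make the birth $0$. *)
Lemma beta_diagramN M p s : beta_diagram M p ->
  Bsp M s (reduced_at M p) -> (p.2 <= s)%N.
Proof.
case: p => b [|d] [/= b0 [//]] _ bE Bv; rewrite leqNgt; apply/negP => /= sd.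
suff : (beta M d <= 0)%N by rewrite -bE; lia.
by apply: ZBsp_reduced; rewrite ZBsp0; apply: Bsp_le Bv; lia.
Qed.

Lemma beta_diagram_inj M p p' : beta_diagram M p -> beta_diagram M p' ->
  p.2 = p'.2 -> p = p'.
Proof. by case: p p' => [b d] [b' d'] [/= _ [_ ->]] [/= _ [_ ->]] ->. Qed.

(** Deaths are distinct, so in a vanishing combination the term of largest death with nonzero
    coefficient would lie in an earlier $B_s$, against [beta_diagramN]. *)
Lemma beta_diagram_free M (l : seq (nat * nat)) (c : nat * nat -> F) :
  uniq l -> (forall p, p \in l -> beta_diagram M p) ->
  \sum_(p <- l) c p *: reduced_at M p = 0 -> forall p, p \in l -> c p = 0.
Proof.
move=> ul lD l0; pose N := (\sum_(p <- l) p.2)%N.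
have lN p : p \in l -> (p.2 <= N)%N.
  by move=> pl; rewrite /N (big_rem p)//= leq_addr.
suff H k p : p \in l -> (N < p.2 + k)%N -> c p = 0.
  by move=> p pl; apply: (H N.+1) => //; lia.
(* Downward induction on the death: stage [k] covers the deaths above [N - k]. *)
elim: k p => [|k IH] p pl Np; first by have := lN _ pl; lia.
apply/eqP; apply/negP => /negP cp.
have := lD _ pl; set w := reduced_at M p => Dp.
have Bw : Bsp M p.2.-1 w.
  apply: (linear_set_cancel (linear_set_Bsp M p.2.-1) cp
    (v := \sum_(i <- l | i != p) c i *: reduced_at M i)).
    apply: linear_set_sum; first exact: linear_set_Bsp.
    move=> /= i il ip; have Di := lD _ il.
    case: (ssrnat.ltngtP i.2 p.2) => ip2.
    - apply: (linear_setZ _ (linear_set_Bsp _ _)).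
      by apply: Bsp_le (beta_diagram_Bsp Di); lia.
    - by rewrite IH ?scale0r//; [case: (linear_set_Bsp M p.2.-1)|lia].
    - by rewrite (beta_diagram_inj Di Dp ip2) eqxx in ip.
  by rewrite (bigD1_seq p)//= in l0; rewrite l0; case: (linear_set_Bsp M p.2.-1).
by have := beta_diagramN Dp Bw; case: Dp => _ []; lia.
Qed.

Lemma beta_diagram_Delta M : beta_diagram M `<=` Delta.
Proof.
by case=> b [|d] [/= b0 [//]] _ bE; rewrite /Delta/= b0 bE beta_le.
Qed.

Lemma beta_diagramP M : exhaustive M -> is_verbose_diagram M (beta_diagram M).
Proof.
move=> exM; split; first exact: beta_diagram_Delta.
exists (reduced_at M).
(* One criterion serves all three basis conditions: [A] must contain every pair of the diagram in
   the rectangle that [beta_diagram_span] uses for [u]. *)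
have bas (U : set {poly F}) (A : set (nat * nat)) :
    A `<=` beta_diagram M -> (forall p, A p -> U (reduced_at M p)) ->
    (forall u, U u -> exists r s, [/\ Bsp M s u, Zsp r u &
       beta_diagram M `&` [set p | (p.1 <= r)%N /\ (p.2 <= s)%N] `<=` A]) ->
    is_basis U A (reduced_at M).
  move=> AD AU UA; split=> // [l c ul lA|u /UA[r [s [Bu Zu rsA]]]].
    by apply: beta_diagram_free => // p /lA /AD.
  have [l [c [lP uE]]] := beta_diagram_span Bu Zu.
  by exists l, c; split=> // p /lP[Dp rs]; apply: rsA.
split.
- apply: bas => // u _; have [s Bu] := exhaustiveP exM u.
  by exists (size u), s; split=> //; apply/ZspE.
- move=> p Dp; have [p1 [p2 pE]] := Dp; split; split=> /=.
  + by split=> //; apply: beta_diagram_Zsp.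
  + by move=> k [k0 Zv]; rewrite pE; apply: ZBsp_reduced; apply: Zsp_ZBsp.
  + by split=> //; apply: beta_diagram_Bsp.
  + by move=> k [k0 Bv]; apply: beta_diagramN Bv.
- move=> r s r0 s0; apply: bas; first exact: subIsetl.
    move=> p [Dp [/= pr ps]]; split.
      by apply: Zsp_le (beta_diagram_Zsp Dp); case/andP: pr.
    by apply: Bsp_le (beta_diagram_Bsp Dp); case/andP: ps.
  move=> u [Zu Bu]; exists r, s; split=> // p [Dp [/= pr ps]].
  by split=> //; case: Dp => p1 [p2 _]; split; apply/andP.
- move=> r r0; apply: bas; first exact: subIsetl.
    move=> p [Dp [/= pr _]].
    by apply: Zsp_le (beta_diagram_Zsp Dp); case/andP: pr.
  move=> u Zu; have [s Bu] := exhaustiveP exM u.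
  exists r, s; split=> // p [Dp [/= pr ps]].
  by split=> //; case: Dp => p1 [p2 _]; split=> //; apply/andP.
Qed.

(** Each unit vector is a finite combination of basis vectors of finite death; the sum of these
    deaths bounds them all. *)
Lemma verbose_diagram_exhaustive M D : is_verbose_diagram M D -> exhaustive M.
Proof.
move=> [_ [v [[_ _ spanT] bd _ _]]] k.
have [l [c [lD ->]]] := spanT 'X^k I.
exists (\sum_(p <- l) p.2)%N; apply: linear_set_sum; first exact: linear_set_Bsp.
move=> p pl _; apply: (linear_setZ _ (linear_set_Bsp _ _)).
have [_ [[_ Bv] _]] := bd _ (lD _ pl).
by apply: Bsp_le Bv; rewrite (big_rem p)//= leq_addr.
Qed.

(** Spanning lists in [is_basis] may repeat indices, while independence speaks of duplicate-free
    lists; this merges the repetitions. *)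
Lemma sum_count (V : lmodType F) (I : eqType) (l t : seq I) (c : I -> F)
    (v : I -> V) : uniq t -> {subset l <= t} ->
  \sum_(p <- l) c p *: v p = \sum_(p <- t) (c p *+ count_mem p l) *: v p.
Proof.
move=> ut; elim: l => [|x l IH] lt.
  by rewrite big_nil big1// => p _; rewrite scale0r.
rewrite big_cons IH; last by move=> p pl; apply: lt; rewrite inE pl orbT.
have xt : x \in t by apply: lt; rewrite mem_head.
rewrite (bigD1_seq x)// [RHS](bigD1_seq x)//= eqxx mulrnDr mulr1n scalerDl -addrA.
congr (_ + (_ + _)); apply: eq_bigr => p px.
by rewrite [x == p]eq_sym (negbTE px).
Qed.

Lemma basis_sum_notin (U : set {poly F}) A (v : nat * nat -> {poly F}) p
    (l1 l2 : seq (nat * nat)) (c1 c2 : nat * nat -> F) :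
  is_basis U A v -> A p ->
  (forall i, i \in l1 -> A i /\ i <> p) -> (forall i, i \in l2 -> A i /\ i <> p) ->
  v p <> \sum_(i <- l1) c1 i *: v i + \sum_(i <- l2) c2 i *: v i.
Proof.
move=> [_ free _] Ap l1A l2A vE.
pose t := undup (p :: l1 ++ l2).
have ut : uniq t := undup_uniq _.
have tp : p \in t by rewrite mem_undup mem_head.
have tA i : i \in t -> A i.
  by rewrite mem_undup inE mem_cat => /predU1P[->//|/orP[/l1A[]|/l2A[]]].
(* Coefficients of the right-hand side minus [v p]; the one at [p] is $-1$. *)
pose c i := c1 i *+ count_mem i l1 + c2 i *+ count_mem i l2 - (i == p)%:R.
have : c p = 0.
  apply: (free t) => //; rewrite /c.
  under eq_bigr do rewrite scalerBl scalerDl.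
  rewrite sumrB big_split/= -!sum_count//.
  - rewrite -vE (bigD1_seq p)//= eqxx scale1r big1 ?addr0 ?subrr//.
    by move=> i /negbTE ->; rewrite scale0r.
  - by move=> i il; rewrite mem_undup inE mem_cat il !orbT.
  - by move=> i il; rewrite mem_undup inE mem_cat il orbT.
have c0 l : (forall i, i \in l -> A i /\ i <> p) -> count_mem p l = 0%N.
  by move=> lA; apply/count_memPn/negP => /lA[].
by rewrite /c !c0// !mulr0n addr0 add0r eqxx => /eqP; rewrite oppr_eq0 oner_eq0.
Qed.

(* The right-hand side does not mention D: this gives uniqueness. *)
Lemma verbose_diagramE M D : is_verbose_diagram M D ->
  D = [set p | [/\ (0 < p.1)%N, (0 < p.2)%N &
    exists2 u, Zsp p.1 u /\ Bsp M p.2 u &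
      forall y z, Zsp p.1.-1 y -> Bsp M p.2 y -> Zsp p.1 z -> Bsp M p.2.-1 z ->
        u <> y + z]].
Proof.
move=> [DD [v [basT bd basR _]]]; apply/seteqP; split=> [[b d] Dp|[b d] /=].
  have /andP[/= b0 bd'] := DD _ Dp.
  have [[[_ Zv] minZ] [[_ Bv] minB]] := bd _ Dp.
  have d0 : (0 < d)%N by lia.
  (* This basis vector is not in $Z_{b-1} \cap B_d + Z_b \cap B_{d-1}$, since both summands are
     spanned by other basis vectors. *)
  split=> //; exists (v (b, d)) => //= y z Zy By Zz Bz.
  have [l1 [c1 [l1D yE]]] : exists (l : seq (nat * nat)) (c : nat * nat -> F),
      (forall i, i \in l -> D i /\ i <> (b, d)) /\ y = \sum_(i <- l) c i *: v i.
    have [b1|b1] := posnP b.-1.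
      exists [::], (fun=> 0); split=> //; rewrite big_nil; apply: Zsp0.
      by rewrite -b1.
    have [_ _ sp] := basR b.-1 d b1 d0.
    have [l [c [lD yE]]] := sp y (conj Zy By).
    exists l, c; split=> // i /lD [Di [/= ib _]]; split=> // ibd.
    by move: ib; rewrite ibd/= => /andP[]; lia.
  have [l2 [c2 [l2D zE]]] : exists (l : seq (nat * nat)) (c : nat * nat -> F),
      (forall i, i \in l -> D i /\ i <> (b, d)) /\ z = \sum_(i <- l) c i *: v i.
    have [d1|d1] := posnP d.-1.
      exists [::], (fun=> 0); split=> //; rewrite big_nil; apply: (@Bsp0 _ M).
      by rewrite -d1.
    have [_ _ sp] := basR b d.-1 b0 d1.
    have [l [c [lD zE]]] := sp z (conj Zz Bz).
    exists l, c; split=> // i /lD [Di [/= _ ib]]; split=> // ibd.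
    by move: ib; rewrite ibd/= => /andP[]; lia.
  by rewrite yE zE; apply: basis_sum_notin basT Dp l1D l2D.
move=> [b0 d0 [u [Zu Bu] uN]].
have [_ _ sp] := basR b d b0 d0; have [l [c [lD uE]]] := sp u (conj Zu Bu).
apply: contrapT => nD.
have lv (i : nat * nat) : i \in l ->
    [/\ Zsp i.1 (v i), Bsp M i.2 (v i), (i.1 <= b)%N, (i.2 <= d)%N
    & ~ (i.1 = b /\ i.2 = d)].
  move=> /lD[Di [/= ib id]]; have [[[_ Zv] _] [[_ Bv] _]] := bd _ Di.
  split=> //; [by case/andP: ib|by case/andP: id|].
  by move=> [i1 i2]; apply: nD; rewrite -i1 -i2 -surjective_pairing.
(* Without $(b,d)$ in [D], a basis vector in the rectangle has birth below $b$, or birth $b$ and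
   death below $d$; this splits [u] in the excluded way. *)
apply: (uN (\sum_(i <- l | (i.1 < b)%N) c i *: v i)
  (\sum_(i <- l | ~~ (i.1 < b)%N) c i *: v i)); last by rewrite uE; exact: bigID.
all: apply: linear_set_sum; try exact: linear_set_Zsp; try exact: linear_set_Bsp.
all: move=> /= i /lv [Zi Bi i1 i2 ibd] ib.
- by apply: (linear_setZ _ (linear_set_Zsp _ _)); apply: Zsp_le Zi; lia.
- by apply: (linear_setZ _ (linear_set_Bsp _ _)); apply: Bsp_le Bi; lia.
- by apply: (linear_setZ _ (linear_set_Zsp _ _)); apply: Zsp_le Zi; lia.
- by apply: (linear_setZ _ (linear_set_Bsp _ _)); apply: Bsp_le Bi; lia.
Qed.

(** The existence of [D] makes [M] exhaustive, so [beta_diagram M] is a verbose diagram too, and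
    [verbose_diagramE] gives both the same value. *)
Lemma verbose_diagram_beta M D :
  is_verbose_diagram M D -> D = beta_diagram M.
Proof.
move=> vD; rewrite (verbose_diagramE vD).
exact/esym/verbose_diagramE/beta_diagramP/(verbose_diagram_exhaustive vD).
Qed.

Lemma exhaustive_verbose_diagram M :
  exhaustive M -> verbose_diagram M = beta_diagram M.
Proof.
move=> exM; apply: verbose_diagram_beta.
exact: (@xgetPex _ _ _ (ex_intro _ _ (beta_diagramP exM))).
Qed.

Lemma nonexhaustive_verbose_diagram M :
  ~ exhaustive M -> verbose_diagram M = set0.
Proof.
by move=> nex; apply: xgetPN => D /verbose_diagram_exhaustive.
Qed.

(** A death fixes its birth through [beta], and a birth fixes its death by [beta_inj]. *)
Lemma admissible_beta_diagram M n : admissible n (beta_diagram M `&` square n).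
Proof.
split.
- by move=> p [/beta_diagram_Delta Dp pn].
- move=> b d d' [[/= b0 [d0 bE]] _] [[/= _ [d0' bE']] _].
  have : d.-1 = d'.-1 by apply: (@beta_inj _ M); rewrite -bE.
  lia.
- by move=> b b' d [[/= _ [_ ->]] _] [[/= _ [_ ->]] _].
Qed.

End Diagram.

(** * Counting and averaging over rows *)

Section Counting.
Variable F : finFieldType.
Implicit Types (M : nat -> nat -> F) (u v : {poly F}) (V : set {poly F}).

Definition cnt m V : nat := #|[pred x : 'rV[F]_m | `[< V (rVpoly x) >]]|.

Lemma eq_cnt m V V' : (forall u, Zsp m u -> V u <-> V' u) -> cnt m V = cnt m V'.
Proof.
move=> VV'; apply: eq_card => x; rewrite !inE; apply/asboolP/asboolP => /VV'; apply;
  by apply/ZspE/size_poly.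
Qed.

(** The set is $V + Fv$; as $v \notin V$, the map $(a,x) \mapsto av + x$ is injective on $F \times
    V$. *)
Lemma cnt_extend m V v : linear_set V -> Zsp m v -> ~ V v ->
  cnt m [set u | exists a, V (u - a *: v)] = (#|F| * cnt m V)%N.
Proof.
move=> sV Zv nVv.
pose f (ax : F * 'rV[F]_m) := ax.1 *: poly_rV v + ax.2.
have vK : rVpoly (poly_rV v : 'rV_m) = v by apply: poly_rV_K; apply/ZspE.
have fE ax : rVpoly (f ax) = ax.1 *: v + rVpoly ax.2.
  by rewrite /f linearD linearZ/= vK.
pose W := [pred x : 'rV[F]_m | `[< V (rVpoly x) >]].
rewrite /cnt -/W -(cardsE W) -(cardsT F) -cardsX -(card_in_imset (f := f)).
  rewrite -[LHS]cardsE; congr #|pred_of_set _|; apply/setP => x; rewrite !inE.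
  apply/asboolP/imsetP => [[a Va]|[ax]].
    exists (a, x - a *: poly_rV v); last by rewrite /f/= addrC subrK.
    by rewrite !inE/= linearB linearZ/= vK.
  by rewrite !inE/= => Vx ->; exists ax.1; rewrite fE addrAC subrr add0r.
move=> [a x] [a' x']; rewrite !inE/= => Vx Vx' ff.
have /(congr1 (@rVpoly F m)) := ff; rewrite !fE/= => E.
have aa' : a = a'.
  apply/eqP; rewrite -subr_eq0; apply: contrapT => /negP d0; apply: nVv.
  have [V0 _] := sV; apply: (linear_set_cancel sV d0 V0).
  rewrite addr0 scalerBl (_ : _ - _ = rVpoly x' - rVpoly x); first exact: linear_setB.
  by rewrite -[a *: v](addrK (rVpoly x)) E addrC -addrA addKr.
by move: ff; rewrite /f/= aa' => /addrI ->.
Qed.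

Lemma cnt_Zsp m b : (b <= m)%N -> cnt m (@Zsp F b) = (#|F| ^ b)%N.
Proof.
elim: b => [_|b IH bm].
  rewrite expn0 -(card1 (0 : 'rV[F]_m)); apply: eq_card => x; rewrite !inE.
  apply/asboolP/eqP => [/Zsp0 x0|->]; last by rewrite linear0; case: (linear_set_Zsp F 0).
  by rewrite -[x]rVpolyK x0 linear0.
rewrite expnS -IH ?(ltnW bm)//.
have <- : [set u | exists a, @Zsp F b (u - a *: 'X^b)] = Zsp b.+1.
  apply/seteqP; split=> [u [a Zu]|u Zu].
    rewrite -[u](subrK (a *: 'X^b)); apply: (linear_setD (linear_set_Zsp F _)).
      exact: Zsp_le Zu.
    by apply: (linear_setZ _ (linear_set_Zsp F _)); apply/ZspE; rewrite size_polyXn.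
  exists u`_b => -[//|i] bi; rewrite /vcoord/= coefB coefZ coefXn.
  case: eqVneq => [->|ib]; first by rewrite mulr1 subrr.
  by rewrite mulr0 subr0; apply: (Zu i.+1); lia.
apply: cnt_extend; first exact: linear_set_Zsp.
- by apply/ZspE; rewrite size_polyXn.
- by move/ZspE; rewrite size_polyXn ltnn.
Qed.

(** This is $\dim (Z_b + B_s) - b$; for $b = 0$ it is $\dim B_s$. *)
Definition exceed M b s : nat := (\sum_(i < s) (b < beta M i))%N.

(** Row $s+1$ adds a dimension to $Z_b + B_s$ exactly when it lies outside, that is, when its birth
    exceeds $b$. *)
Lemma cnt_ZBsp M b s m : (b <= m)%N -> (s <= m)%N ->
  cnt m (ZBsp M b s) = (#|F| ^ (b + exceed M b s))%N.
Proof.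
move=> bm; elim: s => [_|s IH sm].
  rewrite /exceed big_ord0 addn0 -(cnt_Zsp bm); apply: eq_cnt => u _.
  split=> [[y /Bsp0 ->]|]; first by rewrite subr0.
  exact: Zsp_ZBsp.
rewrite /exceed big_ord_recr/= -/(exceed M b s).
have -> : ZBsp M b s.+1 = [set u | exists a, ZBsp M b s (u - a *: row_vec M s.+1)].
  by apply/seteqP; split=> u /ZBspS.
case: ltnP => [bs|sb]; last first.
  rewrite addn0 -IH ?(ltnW sm)//; apply: eq_cnt => u _; split=> [[a Wu]|Wu].
    rewrite -[u](subrK (a *: row_vec M s.+1)).
    apply: (linear_setD (linear_set_ZBsp M b s)) => //.
    by apply: (linear_setZ _ (linear_set_ZBsp M b s)); apply/beta_leE.
  by exists 0; rewrite scale0r subr0.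
rewrite addn1 addnS expnS -IH ?(ltnW sm)//.
apply: cnt_extend; first exact: linear_set_ZBsp.
- by apply/ZspE/(leq_trans (size_poly _ _)).
- by move/beta_leE; rewrite leqNgt bs.
Qed.

Definition set_row M m (x : 'rV[F]_m) : nat -> nat -> F :=
  fun i j => if i == m then (rVpoly x)`_j.-1 else M i j.

Lemma set_row_lt M m (x : 'rV[F]_m) i : (i < m)%N ->
  row_vec (set_row M x) i = row_vec M i.
Proof.
move=> im; apply/polyP => k; rewrite !coef_poly /set_row.
by case: ltnP => // _; rewrite ifF//; apply/negbTE; rewrite neq_ltn im.
Qed.

Lemma set_row_eq M m (x : 'rV[F]_m) : row_vec (set_row M x) m = rVpoly x.
Proof.
apply/polyP => k; rewrite coef_poly /set_row eqxx/=.
by case: ltnP => // mk; rewrite nth_default// (leq_trans (size_poly _ _)).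
Qed.

Lemma Bsp_set_row M s (x : 'rV[F]_s.+1) : Bsp (set_row M x) s = Bsp M s.
Proof. by apply: eq_Bsp => i ils; rewrite set_row_lt. Qed.

Lemma ZBsp_set_row M b s (x : 'rV[F]_s.+1) : ZBsp (set_row M x) b s = ZBsp M b s.
Proof. by apply: eq_ZBsp => i ils; rewrite set_row_lt. Qed.

Lemma beta_set_row M s (x : 'rV[F]_s.+1) i : (i < s)%N ->
  beta (set_row M x) i = beta M i.
Proof. by move=> ilt; apply: eq_beta => j ji; rewrite set_row_lt//; lia. Qed.

Lemma beta_set_row_le M s (x : 'rV[F]_s.+1) b :
  (beta (set_row M x) s <= b)%N <-> ZBsp M b s (rVpoly x).
Proof. by rewrite beta_leE set_row_eq ZBsp_set_row. Qed.

Lemma exceed_set_row M b s (x : 'rV[F]_s.+1) :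
  exceed (set_row M x) b s.+1 =
  (exceed M b s + ~~ `[< ZBsp M b s (rVpoly x) >])%N.
Proof.
rewrite /exceed big_ord_recr/=; congr (_ + nat_of_bool _)%N.
  by apply: eq_bigr => i _; rewrite beta_set_row.
by rewrite ltnNge; congr (~~ _); apply/idP/asboolP => /beta_set_row_le.
Qed.

End Counting.

(** * Means over uniform lower triangular matrices *)

Section Averaging.
Variables (F : finFieldType) (R : realType).
Implicit Types (M : nat -> nat -> F) (phi psi : (nat -> nat -> F) -> R).

Let q : R := #|F|%:R.

Lemma q_gt1 : 1 < q.
Proof. by rewrite /q ltr1n card_finNzRing_gt1. Qed.

Let q_gt0 : 0 < q. Proof. exact: lt_trans q_gt1. Qed.
Let q_neq0 : q != 0. Proof. exact: lt0r_neq0. Qed.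

Definition row_mean m phi M : R := (\sum_(x : 'rV[F]_m) phi (set_row M x)) / q ^+ m.

(** The last row is averaged first, so [row_mean] acts as the conditional expectation given the
    earlier rows. *)
Fixpoint avg s phi : R :=
  if s is s'.+1 then avg s' (row_mean s phi) else phi (fun _ _ => 0).

Lemma eq_avg s phi psi : phi =1 psi -> avg s phi = avg s psi.
Proof.
elim: s phi psi => [|s IH] phi psi E /=; first exact: E.
by apply: IH => M; rewrite /row_mean; under eq_bigr do rewrite E.
Qed.

Lemma avg_le s phi psi : (forall M, phi M <= psi M) -> avg s phi <= avg s psi.
Proof.
elim: s phi psi => [|s IH] phi psi E /=; first exact: E.
apply: IH => M; rewrite /row_mean ler_pM2r ?invr_gt0 ?exprn_gt0//.
by apply: ler_sum => x _.
Qed.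

Lemma avgD s phi psi : avg s (fun M => phi M + psi M) = avg s phi + avg s psi.
Proof.
elim: s phi psi => [//|s IH] phi psi /=; rewrite -IH; apply: eq_avg => M.
by rewrite /row_mean big_split/= mulrDl.
Qed.

Lemma avgZ s a phi : avg s (fun M => a * phi M) = a * avg s phi.
Proof.
elim: s phi => [//|s IH] phi /=; rewrite -IH; apply: eq_avg => M.
by rewrite /row_mean -mulr_sumr mulrA.
Qed.

Lemma avg_ge0 s phi : (forall M, 0 <= phi M) -> 0 <= avg s phi.
Proof.
move=> phi0; rewrite -(mul0r (avg s phi)) -avgZ; apply: avg_le => M.
by rewrite mul0r.
Qed.

Lemma avg_sum (I : finType) s (phi : I -> (nat -> nat -> F) -> R) :
  avg s (fun M => \sum_i phi i M) = \sum_i avg s (phi i).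
Proof.
elim: s phi => [//|s IH] phi /=; rewrite -IH; apply: eq_avg => M.
by rewrite /row_mean exchange_big/= mulr_suml.
Qed.

Definition indic (Q : Prop) : R := `[< Q >]%:R.

Lemma indicT (Q : Prop) : Q -> indic Q = 1.
Proof. by move=> HQ; rewrite /indic asboolT. Qed.

Lemma indicF (Q : Prop) : ~ Q -> indic Q = 0.
Proof. by move=> HQ; rewrite /indic asboolF. Qed.

Lemma sum_indic m (V : set {poly F}) :
  \sum_(x : 'rV[F]_m) indic (V (rVpoly x)) = (cnt m V)%:R.
Proof.
rewrite /cnt -sum1_card natr_sum [RHS]big_mkcond/=; apply: eq_bigr => x _.
by rewrite inE /indic; case: asboolP.
Qed.

Lemma sum_one m : \sum_(x : 'rV[F]_m) (1 : R) = q ^+ m.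
Proof. by rewrite sumr_const card_mx mul1n natrX. Qed.

Lemma sum_ZBsp M b s m : (b <= m)%N -> (s <= m)%N ->
  \sum_(x : 'rV[F]_m) indic (ZBsp M b s (rVpoly x)) = q ^+ (b + exceed M b s).
Proof. by move=> bm sm; rewrite sum_indic cnt_ZBsp// natrX. Qed.

(** A uniform row must fall in $Z_b + B_s$ but, for $b > 0$, not in $Z_{b-1} + B_s$. As $b$ is not
    yet a birth, the first space has exactly one dimension more, whence the factor $(q-1)/q$. *)
Lemma row_mean_beta M s b : (b <= s.+1)%N ->
  (forall i, (i < s)%N -> (0 < b)%N -> beta M i <> b) ->
  row_mean s.+1 (fun M' => indic (beta M' s = b)) M =
  ((q - 1) / q) ^+ (0 < b)%N * q ^+ (b + exceed M b s) / q ^+ s.+1.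
Proof.
move=> bs bN; rewrite /row_mean; congr (_ / _).
case: b bs bN => [|b] bs bN.
  rewrite expr0 mul1r -(@sum_ZBsp M 0 s s.+1)//; apply: eq_bigr => x _; congr (_%:R).
  congr nat_of_bool; apply/asboolP/asboolP => [b0|Wx].
    by apply/beta_set_row_le; rewrite b0.
  by apply/eqP; rewrite -leqn0; apply/beta_set_row_le.
have -> : exceed M b.+1 s = exceed M b s.
  apply: eq_bigr => i _; congr nat_of_bool; rewrite [RHS]leq_eqVlt.
  by case: eqP => // /esym/bN; case.
rewrite expr1 addSn exprS mulrA divfK// mulrBl mul1r -exprS -[X in q ^+ X - _]addSn.
rewrite -(@sum_ZBsp M b s s.+1)//; last exact: ltnW.
have <- : exceed M b.+1 s = exceed M b s.
  apply: eq_bigr => i _; congr nat_of_bool; rewrite [RHS]leq_eqVlt.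
  by case: eqP => // /esym/bN; case.
rewrite -(@sum_ZBsp M b.+1 s s.+1)// -sumrB; apply: eq_bigr => x _.
have := beta_set_row_le M x b.+1; have := beta_set_row_le M x b.
set t := beta _ _; rewrite /indic => bP bP'.
have -> : `[< ZBsp M b.+1 s (rVpoly x) >] = (t <= b.+1)%N
  by apply/asboolP/idP; rewrite bP'.
have -> : `[< ZBsp M b s (rVpoly x) >] = (t <= b)%N by apply/asboolP/idP; rewrite bP.
have -> : `[< t = b.+1 >] = (t == b.+1) by apply/asboolP/eqP.
rewrite [in X in _ = X - _]leq_eqVlt ltnS; case: eqVneq => [->|]/=.
  by rewrite ltnn subr0.
by rewrite subrr.
Qed.

(** The multiplication rule for conditional probabilities: once the earlier births are prescribed,
    [exceed] is determined. *)
Lemma avg_beta n (b : nat -> nat) :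
  (forall s, (s < n)%N -> (b s <= s.+1)%N) ->
  (forall i s, (i < s < n)%N -> (0 < b s)%N -> b i <> b s) ->
  avg n (fun M => indic (forall s, (s < n)%N -> beta M s = b s)) =
  \prod_(s < n) (((q - 1) / q) ^+ (0 < b s)%N *
     q ^+ (b s + \sum_(i < s) (b s < b i)) / q ^+ s.+1).
Proof.
elim: n => [|n IH] b_le b_inj; first by rewrite big_ord0/= indicT.
rewrite big_ord_recr/= -IH; last first.
- by move=> i s isn; apply: b_inj; lia.
- by move=> s sn; apply: b_le; lia.
rewrite mulrC -avgZ; apply: eq_avg => M.
(* Changing the last row leaves the earlier births alone, so a matrix violating the earlier
   conditions contributes nothing. *)
have [Mb|nMb] := pselect (forall s, (s < n)%N -> beta M s = b s); last first.
  rewrite (indicF nMb) mulr0 /row_mean big1 ?mul0r// => x _; apply: indicF.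
  by move=> Mb; apply: nMb => s sn; rewrite -Mb ?beta_set_row//; lia.
rewrite (indicT Mb) mulr1.
have -> : (\sum_(i < n) (b n < b i) = exceed M (b n) n)%N.
  by apply: eq_bigr => i _; rewrite Mb.
rewrite -row_mean_beta ?b_le//; last first.
  by move=> i ilt b0; rewrite Mb//; apply: b_inj => //; lia.
congr (_ / _); apply: eq_bigr => x _; congr (_%:R); congr nat_of_bool.
apply/asboolP/asboolP => [|xb s]; first exact.
rewrite ltnS leq_eqVlt => /predU1P[->//|sn].
by rewrite beta_set_row// Mb.
Qed.

End Averaging.

(** * Vectors outside all row spaces *)

Section Missing.
Variables (F : finFieldType) (R : realType).
Implicit Types (M : nat -> nat -> F) (e : {poly F}).

Let q : R := #|F|%:R.
Let q_gt0 : 0 < q. Proof. exact: lt_trans (q_gt1 _ _). Qed.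
Let q_neq0 : q != 0. Proof. exact: lt0r_neq0. Qed.

Definition missing e s M : R := indic R (~ Bsp M s e).

(** Equals $q^{c_s}$ with $c_s = s - \dim B_s$. *)
Definition codim_weight s M : R := q ^+ s / q ^+ exceed M 0 s.

Lemma codim_weight_gt0 s M : 0 < codim_weight s M.
Proof. by rewrite divr_gt0// exprn_gt0. Qed.

(** Steinitz exchange: a relation between [e] and the new row modulo $B_s$ with nonzero coefficient
    can be solved for either of them. *)
Lemma Bsp_set_rowS M s e (x : 'rV[F]_s.+1) : ~ Bsp M s e ->
  Bsp (set_row M x) s.+1 e <->
  (exists a, Bsp M s (rVpoly x - a *: e)) /\ ~ Bsp M s (rVpoly x).
Proof.
move=> nBe; have sB := linear_set_Bsp M s; have [B0 _] := sB.
rewrite BspS set_row_eq Bsp_set_row.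
have flip u v a : a != 0 -> Bsp M s (u - a *: v) -> Bsp M s (v - a^-1 *: u).
  move=> a0 /(linear_setZ (- a^-1) sB).
  by rewrite scalerBr scalerA !scaleNr mulNr mulVf// scaleN1r opprK addrC.
split=> [[a Ba]|[[a Ba] nBx]].
- have a0 : a != 0.
    by apply: contra_notN nBe => /eqP a0; move: Ba; rewrite a0 scale0r subr0.
  split; first by exists a^-1; apply: flip.
  move=> Bx; apply: nBe; rewrite -[e](subrK (a *: rVpoly x)).
  by apply: (linear_setD sB) => //; apply: linear_setZ.
- exists a^-1; apply: flip => //.
  by apply: contra_notN nBx => /eqP a0; move: Ba; rewrite a0 scale0r subr0.
Qed.

Lemma Bsp_set_row_mono M s e (x : 'rV[F]_s.+1) :
  Bsp M s e -> Bsp (set_row M x) s.+1 e.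
Proof. by rewrite -(Bsp_set_row M x); apply: Bsp_le. Qed.

Let inB M s (x : 'rV[F]_s.+1) : R := indic R (Bsp M s (rVpoly x)).
Let inBe e M s (x : 'rV[F]_s.+1) : R :=
  indic R (exists a, Bsp M s (rVpoly x - a *: e)).

Let sum_inB M s : \sum_(x : 'rV[F]_s.+1) inB M x = q ^+ exceed M 0 s :> R.
Proof.
rewrite -[exceed M 0 s]add0n -(@sum_ZBsp F R M 0 s s.+1)// ZBsp0.
exact: eq_bigr.
Qed.

Let sum_inBe e M s : Zsp s.+1 e -> ~ Bsp M s e ->
  \sum_(x : 'rV[F]_s.+1) inBe e M x = q * q ^+ exceed M 0 s :> R.
Proof.
move=> Ze nBe; rewrite -sum_inB /inB sum_indic -natrM.
rewrite -(cnt_extend (v := e))//; last exact: linear_set_Bsp.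
by rewrite -sum_indic; apply: eq_bigr.
Qed.

Let missing_set_row e M s (x : 'rV[F]_s.+1) : ~ Bsp M s e ->
  missing e s.+1 (set_row M x) = 1 - inBe e M x + inB M x.
Proof.
move=> nBe; have sB := Bsp_set_rowS x nBe.
have BBe : Bsp M s (rVpoly x) -> exists a, Bsp M s (rVpoly x - a *: e).
  by exists 0; rewrite scale0r subr0.
rewrite /missing /inB /inBe.
have [Be|nBe'] := pselect (exists a, Bsp M s (rVpoly x - a *: e)); last first.
  rewrite (indicF _ nBe') subr0 indicT; last by move=> /sB[].
  by rewrite indicF ?addr0// => /BBe.
rewrite (indicT _ Be) subrr add0r.
have [Bx|nBx] := pselect (Bsp M s (rVpoly x)).
  by rewrite !indicT// => /sB[].
by rewrite !indicF//; apply; apply/sB.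
Qed.

(** The loss comes from new rows in $(B_s + Fe) \setminus B_s$, which have probability $(q-1)
    q^{\dim B_s} / q^{s+1}$. *)
Lemma row_mean_missing e M s : Zsp s.+1 e ->
  row_mean s.+1 (missing e s.+1) M =
  missing e s M - (q - 1) / q * (missing e s M / codim_weight s M).
Proof.
move=> Ze; have [Be|nBe] := pselect (Bsp M s e).
  rewrite /row_mean big1 => [|x _].
    by rewrite /missing indicF ?mul0r ?mulr0 ?subr0.
  by rewrite /missing indicF//; apply; apply: Bsp_set_row_mono.
rewrite /row_mean; under eq_bigr do rewrite missing_set_row//.
rewrite big_split/= sumrB sum_inB sum_inBe// sum_one.
rewrite /missing indicT// /codim_weight exprS.
by field; rewrite q_neq0 !expf_neq0.
Qed.

(* Given that e is still missing, the expected codimension weight is conserved: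
   the decay of the survival probability is exactly compensated by the growth of
   the weight along the rows outside B_s + F e. *)
Lemma row_mean_missing_weight e M s : Zsp s.+1 e ->
  row_mean s.+1 (fun M' => missing e s.+1 M' * codim_weight s.+1 M') M =
  missing e s M * codim_weight s M.
Proof.
move=> Ze; have [Be|nBe] := pselect (Bsp M s e).
  rewrite /row_mean big1 => [|x _].
    by rewrite /missing indicF ?mul0r.
  by rewrite /missing indicF ?mul0r//; apply; apply: Bsp_set_row_mono.
(* A row in $B_s$ multiplies the weight by $q$, one outside $B_s + Fe$ keeps it, and any other
   brings in [e] and contributes $0$. *)
have E (x : 'rV[F]_s.+1) :
    missing e s.+1 (set_row M x) * codim_weight s.+1 (set_row M x) =
    codim_weight s M * (1 - inBe e M x + q * inB M x).
  rewrite missing_set_row// /codim_weight exceed_set_row ZBsp0 /inBe /inB.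
  case: asboolP => [Bx|nBx] /=.
    rewrite !indicT//; last by exists 0; rewrite scale0r subr0.
    by rewrite addn0 exprS; field; rewrite expf_neq0.
  rewrite (indicF _ nBx) mulr0 !addr0 addn1 !exprS.
  by field; rewrite q_neq0 expf_neq0.
rewrite /row_mean; under eq_bigr do rewrite E.
rewrite -mulr_sumr big_split/= sumrB -mulr_sumr sum_inB sum_inBe// sum_one.
(* The size of $B_s + Fe$ cancels against $q$ times the size of $B_s$. *)
rewrite /missing indicT// mul1r addrNK.
by field; rewrite expf_neq0.
Qed.

Lemma avg_missing_cvg0 e k (eps : R) : Zsp k e -> 0 < eps ->
  exists s, avg s (missing e s) < eps.
Proof.
move=> Ze eps0; apply: contrapT => big.
have {}big s : eps <= avg s (missing e s).
  by rewrite leNgt; apply/negP => small; apply: big; exists s.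
pose C := avg k (fun M => missing e k M * codim_weight k M).
have missing_ge0 s M : 0 <= missing e s M by rewrite /missing /indic ler0n.
have C0 : 0 <= C.
  by apply: avg_ge0 => M; rewrite mulr_ge0// ltW// codim_weight_gt0.
(* Conservation needs [e] in $Z_{s+1}$, which is guaranteed from [k] on. *)
have Cs j : avg (j + k) (fun M => missing e (j + k) M * codim_weight (j + k) M) = C.
  elim: j => [//|j <-]; rewrite addSn /=; apply: eq_avg => M.
  by rewrite row_mean_missing_weight//; apply: Zsp_le Ze; lia.
(* [C + 1] avoids division by zero and gives $tC \le \varepsilon$; [delta] is a lower bound for the
   loss in each step. *)
pose t := eps / (C + 1); pose delta := (q - 1) / q * (eps * t).
have t0 : 0 < t by rewrite divr_gt0// ltr_wpDl.
have q1 : 0 < (q - 1) / q by rewrite divr_gt0// subr_gt0 q_gt1.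
have delta0 : 0 < delta by rewrite mulr_gt0// mulr_gt0.
have decay j : avg (j + k) (missing e (j + k)) <= avg k (missing e k) - delta *+ j.
  elim: j => [|j IH]; first by rewrite mulr0n subr0.
  apply: le_trans (_ : avg (j + k) (missing e (j + k)) - delta <= _); last first.
    by rewrite mulrS opprD addrA addrAC lerD2r.
  rewrite addSn /= (@eq_avg _ _ _ _ (fun M => missing e (j + k) M +
    - ((q - 1) / q) * (missing e (j + k) M / codim_weight (j + k) M))); last first.
    by move=> M; rewrite row_mean_missing ?mulNr//; apply: Zsp_le Ze; lia.
  rewrite avgD avgZ lerD2l mulNr lerN2 /delta ler_pM2l//.
  (* Tangent-line substitute $1/u \ge 2t - t^2 u$ for Cauchy-Schwarz, from $(1 - tu)^2 \ge 0$. Its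
     average is at least $2t\varepsilon - t^2 C \ge t\varepsilon$. *)
  have AMGM M : (2 * t) * missing e (j + k) M +
      - t ^+ 2 * (missing e (j + k) M * codim_weight (j + k) M) <=
      missing e (j + k) M / codim_weight (j + k) M.
    have := codim_weight_gt0 (j + k) M; set u := codim_weight _ _ => u0.
    rewrite [_ * (_ * u)]mulrCA [_ * missing _ _ _]mulrC -mulrDr ler_wpM2l//.
    rewrite -subr_ge0 (_ : _ - _ = (1 - t * u) ^+ 2 / u); last first.
      by field; rewrite gt_eqF.
    by rewrite divr_ge0 ?sqr_ge0// ltW.
  apply: le_trans _ (avg_le _ AMGM); rewrite avgD !avgZ Cs.
  have tC : t * C <= eps.
    by rewrite /t mulrAC ler_pdivrMr ?ltr_wpDl// ler_pM2l// lerDl.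
  have := big (j + k)%N; nra.
have f0 : 0 <= avg k (missing e k) / delta.
  by rewrite divr_ge0 ?ltW//; apply: lt_le_trans eps0 _.
(* After [j] steps the total loss would exceed the initial value. *)
have := archi_boundP f0; set j := Num.bound _.
rewrite ltr_pdivrMr// mulr_natl => jP.
have := le_trans (big (j + k)%N) (decay j); rewrite leNgt => /negP; apply.
by apply: le_lt_trans eps0; rewrite subr_le0 ltW.
Qed.

End Missing.

(** * Probabilities of events on finitely many rows *)

Section Cylinders.
Variables (R : realType) (d : measure_display) (T : measurableType d).
Variables (P : probability T R) (F : finFieldType) (L : nat -> nat -> T -> F).
Hypothesis HL : iid_uniform_lower_triangular P L.

Let q : R := #|F|%:R.
Let Lmat (w : T) : nat -> nat -> F := fun i j => L i j w.

(** One implication suffices, as the hypothesis is symmetric in the two matrices. *)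
Definition cylinder s (Q : (nat -> nat -> F) -> Prop) : Prop :=
  forall M M', (forall i j, (1 <= j <= i)%N -> (i <= s)%N -> M i j = M' i j) ->
  Q M -> Q M'.

Lemma cylinder_Bsp s e : cylinder s (fun M => Bsp M s e).
Proof. by move=> M M' MM'; rewrite (eq_Bsp (eq_row MM')). Qed.

Lemma cylinder_beta n (b : nat -> nat) :
  cylinder n (fun M => forall s, (s < n)%N -> beta M s = b s).
Proof.
move=> M M' MM' Mb s sn; rewrite -Mb//; apply/esym/eq_beta => i ilt.
by apply: (eq_row MM'); lia.
Qed.

Lemma cylinder_not s Q : cylinder s Q -> cylinder s (fun M => ~ Q M).
Proof.
move=> cQ M M' MM' nQ QM'; apply: nQ; apply: cQ QM' => i j ji ilt.
by rewrite MM'.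
Qed.

Lemma prob_entries (J : {fset nat * nat}) (a : nat * nat -> F) :
  (forall p, p \in J -> (1 <= p.2 <= p.1)%N) ->
  measurable (\bigcap_(p in [set` J]) (L p.1 p.2 @^-1` [set a p])) /\
  P (\bigcap_(p in [set` J]) (L p.1 p.2 @^-1` [set a p])) =
    (q^-1 ^+ #|` J|)%:E.
Proof.
move=> JP; split.
  apply: fin_bigcap_measurable; first exact: finite_fset.
  by move=> p /= /JP pP; apply: (entry_measurable HL pP).
rewrite (entries_independent HL (fun p => [set a p]) JP) big_seq.
under eq_bigr => p /JP pP do rewrite (entry_uniform HL pP).
rewrite -big_seq prodEFin; congr (_%:E).
by rewrite big_const_seq count_predT iter_mulr_1.
Qed.

Let entry_row s : {fset nat * nat} :=
  seq_fset tt [seq (s.+1, j.+1) | j <- iota 0 s.+1].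

Let entry_rowP s p : (p \in entry_row s) = (p.1 == s.+1) && (1 <= p.2 <= s.+1)%N.
Proof.
rewrite seq_fsetE; apply/mapP/idP => [[j]|].
  by rewrite mem_iota => jP -> /=; rewrite eqxx; lia.
case: p => i j /andP[/eqP /= -> jP]; exists j.-1.
  by rewrite (@mem_iota 0 s.+1 j.-1); lia.
by congr (_, _); lia.
Qed.

Let card_entry_row s : #|` entry_row s| = s.+1.
Proof.
rewrite size_seq_fset undup_id ?size_map ?size_iota// map_inj_uniq ?iota_uniq//.
by move=> i j [].
Qed.

(** The prescribed entries [J] in rows after row [s] carry the induction: row [s.+1] moves from [Q]
    into [J] by summing over its values, until at [s = 0] independence applies. *)
Lemma prob_cylinder_entries s Q (J : {fset nat * nat}) (a : nat * nat -> F) :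
  cylinder s Q -> (forall p, p \in J -> (1 <= p.2 <= p.1)%N && (s < p.1)%N) ->
  let E := [set w | Q (Lmat w) /\ forall p, p \in J -> L p.1 p.2 w = a p] in
  measurable E /\
  P E = (avg s (fun M => indic R (Q M)) * q^-1 ^+ #|` J|)%:E.
Proof.
elim: s Q J a => [|s IH] Q J a cQ JP.
  have JP' p : p \in J -> (1 <= p.2 <= p.1)%N by move=> /JP/andP[].
  have [mJ PJ] := prob_entries a JP'; move=> E.
  have c0 M : Q M <-> Q (fun _ _ => 0) by split; apply: cQ => i j; lia.
  have [Q0|nQ0] := pselect (Q (fun _ _ => 0)); last first.
    have -> : E = set0 by apply/seteqP; split=> // w [/c0].
    by rewrite measure0 /= indicF// mul0r.
  have -> : E = \bigcap_(p in [set` J]) (L p.1 p.2 @^-1` [set a p]).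
    apply/seteqP; split=> w; first by move=> [_ Jw] p /= /Jw.
    by move=> Jw; split; [apply/c0|move=> p pJ; apply: (Jw p)].
  by rewrite /= indicT// mul1r.
pose a' (x : 'rV[F]_s.+1) p := if p.1 == s.+1 then (rVpoly x)`_p.2.-1 else a p.
pose J' := (J `|` entry_row s)%fset.
pose Ex (x : 'rV[F]_s.+1) := [set w | Q (set_row (Lmat w) x) /\
  forall p, p \in J' -> L p.1 p.2 w = a' x p].
move=> E.
have Exw x w : Ex x w -> forall i j, (1 <= j <= i)%N -> (i <= s.+1)%N ->
    set_row (Lmat w) x i j = Lmat w i j.
  move=> [_ xw] i j ji is1; rewrite /set_row /Lmat; case: eqVneq => // iE.
  have := xw (i, j); rewrite /a' /J' in_fsetU entry_rowP /= iE eqxx /= => -> //.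
  by rewrite -iE ji orbT.
have EE : E = \bigcup_(x in [set: 'rV_s.+1]) Ex x.
  apply/seteqP; split=> w; last first.
    move=> [x _ xw]; have [Qx Jx] := xw; split.
      by apply: cQ Qx; apply: Exw.
    move=> p pJ; rewrite Jx; last by rewrite in_fsetU pJ.
    by rewrite /a' gtn_eqF//; have /andP[] := JP _ pJ.
  move=> [Qw Jw]; pose x := \row_(j < s.+1) L s.+1 j.+1 w.
  have xE j : (1 <= j <= s.+1)%N -> (rVpoly x)`_j.-1 = L s.+1 j w.
    case: j => // j /= js; have -> : j = Ordinal js by [].
    by rewrite coef_rVpoly_ord mxE.
  exists x => //; split.
    apply: cQ Qw => i j ji is1; rewrite /set_row /Lmat; case: eqVneq => // iE.
    by rewrite xE -?iE.
  move=> p; rewrite in_fsetU entry_rowP => /orP[pJ|/andP[/eqP p1 p2]].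
    by rewrite /a' gtn_eqF ?Jw//; have /andP[] := JP _ pJ.
  by rewrite /a' p1 eqxx xE.
have Extriv : trivIset [set: 'rV[F]_s.+1] Ex.
  move=> x y _ _ [w [[_ xw] [_ yw]]]; apply/rowP => j.
  have jJ : (s.+1, j.+1) \in J' by rewrite in_fsetU entry_rowP /= eqxx ltn_ord orbT.
  have := xw _ jJ; have := yw _ jJ; rewrite /a' /= eqxx !coef_rVpoly_ord.
  by move=> -> ->.
have J'P p : p \in J' -> (1 <= p.2 <= p.1)%N && (s < p.1)%N.
  rewrite in_fsetU entry_rowP => /orP[/JP/andP[-> /= /ltnW//]|/andP[/eqP -> ->]].
  by rewrite /=.
have cardJ' : #|` J'| = (#|` J| + s.+1)%N.
  rewrite /J' cardfsU card_entry_row (_ : (_ `&` _)%fset = fset0) ?cardfs0 ?subn0//.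
  apply/fsetP => p; rewrite in_fsetI entry_rowP inE; apply/negP.
  by move=> /andP[/JP/andP[_ sp] /andP[/eqP p1]]; rewrite p1 ltnn in sp.
have ExP x := IH (fun M => Q (set_row M x)) J' (a' x).
have cQx (x : 'rV[F]_s.+1) : cylinder s (fun M => Q (set_row M x)).
  move=> M M' MM' QM; apply: cQ QM => i j ji is1; rewrite /set_row.
  by case: eqVneq => // iE; apply: MM' => //; lia.
split.
  rewrite EE; apply: fin_bigcup_measurable; first exact: finite_finset.
  by move=> x _; have [] := ExP x (cQx x) J'P.
rewrite EE measure_fin_bigcup//; first last.
- by move=> x _; have [] := ExP x (cQx x) J'P.
- exact: finite_finset.
have setTE : [set: 'rV[F]_s.+1] = [set` index_enum 'rV[F]_s.+1].
  by apply/seteqP; split=> x //= _; rewrite mem_index_enum.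
rewrite setTE -fsbig_seq ?index_enum_uniq//=.
under eq_bigr => x _ do rewrite (ExP x (cQx x) J'P).2.
(* The $s+1$ entries moved into [J] contribute $q^{-(s+1)}$, the normalisation in [row_mean]. *)
rewrite sumEFin -mulr_suml -avg_sum cardJ' exprD mulrA mulrAC.
congr (_ * _)%:E; rewrite mulrC -avgZ; apply: eq_avg => M.
by rewrite /row_mean mulrC exprVn.
Qed.

Lemma prob_cylinder s Q : cylinder s Q ->
  measurable [set w | Q (Lmat w)] /\
  P [set w | Q (Lmat w)] = (avg s (fun M => indic R (Q M)))%:E.
Proof.
move=> cQ; have [] := @prob_cylinder_entries s Q fset0 (fun=> 0) cQ => [//|].
rewrite cardfs0 expr0 mulr1 (_ : [set w | _ /\ _] = [set w | Q (Lmat w)])//.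
by apply/seteqP; split=> w // [].
Qed.

Lemma measurable_exhaustive : measurable [set w | exhaustive (Lmat w)].
Proof.
rewrite (_ : [set w | _] = \bigcap_k \bigcup_s [set w | Bsp (Lmat w) s 'X^k]).
  apply: bigcapT_measurable => k; apply: bigcupT_measurable => s.
  by have [] := prob_cylinder (@cylinder_Bsp s 'X^k).
apply/seteqP; split=> w; first by move=> ex k _; have [s Bs] := ex k; exists s.
by move=> ex k; have [s _ Bs] := ex k I; exists s.
Qed.

(** By countability one unit vector is enough. The event that it is never reached lies in each event
    that it is missing at [s], and some of these have probability below any [eps]. *)
Lemma ae_exhaustive : {ae P, forall w, exhaustive (Lmat w)}.
Proof.
apply: ae_foralln => k.
pose N := \bigcap_s [set w | ~ Bsp (Lmat w) s 'X^k].
have Nmeas s := prob_cylinder (cylinder_not (@cylinder_Bsp s 'X^k)).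
have mN : measurable N.
  by apply: bigcapT_measurable => s; have [] := Nmeas s.
exists N; split=> //; last first.
  by move=> w /= nex s _ Bs; apply: nex; exists s.
apply/eqP; rewrite -measure_le0; apply/lee_addgt0Pr => eps eps0; rewrite add0e.
have Zk : @Zsp F k.+1 'X^k by apply/ZspE; rewrite size_polyXn.
have [s small] := avg_missing_cvg0 Zk eps0.
have [ms Ps] := Nmeas s.
apply: (@le_trans _ _ (P [set w | ~ Bsp (Lmat w) s 'X^k])).
  by apply: le_measure; rewrite ?inE// => w Nw; apply: Nw.
by rewrite Ps lee_fin ltW.
Qed.

End Cylinders.

(** * Admissible sets *)

Section Columns.
Variables (n : nat) (S : {fset nat * nat}).
Hypothesis admS : admissible n [set` S].

(** The default [0] for an empty column and the shift to death [s.+1] match the conventions of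
    [beta]. *)
Definition column_birth (X : {fset nat * nat}) (s : nat) : nat :=
  head 0%N [seq p.1 | p <- X & p.2 == s.+1].

Let b := column_birth S.

Lemma admissible_bounds p : p \in S -> (1 <= p.1 <= p.2)%N && (p.2 <= n)%N.
Proof.
by case: admS => sub _ _ /sub[]; rewrite /Delta/= => -> [_ /= /andP[]].
Qed.

(** Admissibility allows at most one birth per death, so taking the head of a column loses
    nothing. *)
Lemma filter_column s :
  [seq p <- S | p.2 == s.+1] = if b s == 0%N then [::] else [:: (b s, s.+1)].
Proof.
rewrite /b /column_birth; set l := [seq _ <- _ | _].
have ul : uniq l by apply: filter_uniq; apply: fset_uniq.
have lS p : p \in l -> p \in S /\ p.2 = s.+1.
  by rewrite mem_filter => /andP[/eqP].
case: l ul lS => //= -[i j] l /andP[il _] lS.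
have [ijS /= jE] := lS _ (mem_head _ _).
have /andP[/andP[/= i0 _] _] := admissible_bounds ijS.
rewrite eqn0Ngt i0 /= jE; congr (_ :: _).
case: l il lS => // p l il lS; exfalso; move/negP: il; apply.
have [pS p2] : p \in S /\ p.2 = s.+1 by apply: lS; rewrite !inE eqxx orbT.
case: admS => _ _ inj; rewrite inE jE; apply/orP; left.
case: p pS p2 {lS} => i' j' /= pS p2; rewrite p2 in pS.
by rewrite p2 (inj i i' s.+1)// -jE.
Qed.

Lemma mem_column i s : ((i, s.+1) \in S) = (0 < i)%N && (b s == i).
Proof.
have -> : ((i, s.+1) \in S) = ((i, s.+1) \in [seq p <- S | p.2 == s.+1]).
  by rewrite mem_filter /= eqxx.
rewrite filter_column; case: eqVneq => [->|b0].
  by rewrite in_nil; case: i.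
rewrite inE xpair_eqE eqxx andbT [i == _]eq_sym.
by case: eqVneq => [<-|]; rewrite ?andbF// lt0n b0.
Qed.

Lemma column_birth_le s : (b s <= s.+1)%N.
Proof.
have [->//|b0] := posnP (b s).
have : (b s, s.+1) \in S by rewrite mem_column b0 eqxx.
by move=> /admissible_bounds /andP[/andP[]].
Qed.

Lemma column_birth_inj i s : (i < s)%N -> (0 < b s)%N -> b i <> b s.
Proof.
move=> ilt b0 bE.
have iS : (b s, i.+1) \in S by rewrite mem_column b0 bE eqxx.
have sS : (b s, s.+1) \in S by rewrite mem_column b0 eqxx.
by case: admS => _ inj _; have := inj _ _ _ iS sS; lia.
Qed.

Lemma birth_atE s :
  birth_at S s.+1 = if b s == 0%N then -oo%E else ((b s)%:Z)%:E.
Proof. by rewrite /birth_at filter_column; case: eqVneq. Qed.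

(** Coding $-\infty$ as [0] respects the strict order because actual births are positive. *)
Lemma birth_at_lt i j : (birth_at S i.+1 < birth_at S j.+1)%E = (b i < b j)%N.
Proof.
rewrite !birth_atE.
case: (eqVneq (b i)) => [->|i0]; case: (eqVneq (b j)) => [->|j0] //=.
by rewrite ltNyr lt0n j0.
Qed.

(** Sorts the pairs by death; an empty column gets the factor [0]. *)
Lemma sum_columns (f : nat * nat -> nat) :
  (\sum_(p <- S) f p = \sum_(s < n) (0 < b s) * f (b s, s.+1))%N.
Proof.
transitivity (\sum_(p <- S) \sum_(s < n | p.2 == s.+1) f p)%N.
  rewrite big_seq [RHS]big_seq; apply: eq_bigr => p pS.
  have /andP[/andP[p1 p12] p2] := admissible_bounds pS.
  have pn : (p.2.-1 < n)%N by case: p.2 p1 p12 p2 => //; lia.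
  rewrite (big_pred1 (Ordinal pn))// => s /=.
  by rewrite -val_eqE /= -eqSS prednK ?(leq_trans p1)// eq_sym.
rewrite (exchange_big_dep xpredT)//=; apply: eq_bigr => s _.
rewrite -big_filter filter_column.
by case: eqVneq => [->|b0]; rewrite ?big_nil ?big_seq1 ?lt0n ?b0 ?mul1n.
Qed.

Lemma card_columns : #|` S| = (\sum_(s < n) (0 < b s))%N.
Proof.
rewrite -sum1_size sum_columns.
by apply: eq_bigr => s _; rewrite muln1.
Qed.

Lemma Sigma_columns : Sigma S = (\sum_(s < n) b s)%N.
Proof.
rewrite /Sigma sum_columns; apply: eq_bigr => s _ /=.
by case: posnP => [->|_]; rewrite ?mul1n.
Qed.

Lemma inversions_columns :
  inversions n S = (\sum_(s < n) \sum_(i < s) (b s < b i))%N.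
Proof.
rewrite /inversions -sum1_card big_mkcond /=.
transitivity (\sum_(p : 'I_n * 'I_n) ((p.1 < p.2) && (b p.2 < b p.1))%N : nat)%N.
  by apply: eq_bigr => p _; rewrite inE birth_at_lt; case: (_ && _).
rewrite -(pair_bigA _ (fun i j : 'I_n => ((i < j) && (b j < b i))%N : nat)) /=.
rewrite exchange_big /=; apply: eq_bigr => s _.
rewrite (big_ord_widen_cond n xpredT (fun i => (b s < b i)%N : nat))
  ?(ltnW (ltn_ord s))//.
rewrite [RHS]big_mkcond /=; apply: eq_bigr => i _.
by case: ltnP; rewrite ?andbT ?andbF.
Qed.

(** Turns a prescribed diagram in the square into prescribed values of [beta] on the first [n] rows,
    the event that [avg_beta] evaluates. *)
Lemma beta_diagram_columns (F : fieldType) (M : nat -> nat -> F) :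
  beta_diagram M `&` square n = [set` S] <->
  (forall s, (s < n)%N -> beta M s = b s).
Proof.
split=> [DS s sn|Mb].
  have Db i : (0 < i)%N -> i = beta M s <-> b s == i.
    move=> i0; have := mem_column i s; rewrite i0 /= => <-.
    have -> : (i, s.+1) \in S <-> (beta_diagram M `&` square n) (i, s.+1).
      by rewrite DS.
    split=> [iE|[[_ [_ /= ->]]]//]; split; first by [].
    by split=> /=; apply/andP; split=> //; rewrite iE; have := beta_le M s; lia.
  have [b0|b0] := posnP (b s); last by apply/esym/Db.
  rewrite b0; apply/eqP; rewrite -leqn0 leqNgt; apply/negP => beta0.
  have /(Db _ beta0) := erefl (beta M s).
  by rewrite b0 => /eqP bE; rewrite -bE in beta0.
apply/seteqP; split=> -[i [|s]] /=; first by case=> [[_ []]].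
- move=> [[/= i0 [_ iE]] [_ /= /andP[_ sn]]].
  by rewrite mem_column i0 iE Mb/=.
- by move=> /admissible_bounds /= /andP[/andP[]]; lia.
move=> iS; have /andP[/andP[/= i0 is1] sn] := admissible_bounds iS.
move: iS; rewrite mem_column i0 /= => /eqP bE.
split; first by split=> //=; split=> //; rewrite Mb.
by split; apply/andP; split=> //=; apply: leq_trans is1 _.
Qed.

End Columns.

(** * The law of the diagram in a square *)

Theorem theorem2 (R : realType) (d : measure_display) (T : measurableType d)
    (P : probability T R) (F : finFieldType) (L : nat -> nat -> T -> F)
    (HL : iid_uniform_lower_triangular P L) (n : nat) (n_gt0 : (1 <= n)%N) :
  let q : R := #|F|%:R in
  let PD : T -> set (nat * nat) :=
    fun w => verbose_diagram (fun i j => L i j w) in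
  {ae P, forall w,
     unique (is_verbose_diagram (fun i j => L i j w)) (PD w) /\
     admissible n (PD w `&` square n)} /\
  (forall S : {fset nat * nat}, admissible n [set` S] ->
     measurable [set w | PD w `&` square n = [set` S]] /\
     P [set w | PD w `&` square n = [set` S]] =
       (((q - 1) / q) ^+ #|` S| *
        q ^ ((Sigma S)%:Z + (inversions n S)%:Z - ('C(n.+1, 2))%:Z))%:E).
Proof.
move=> q PD; split.
  apply: filterS (ae_exhaustive HL) => w ex.
  rewrite /PD exhaustive_verbose_diagram//.
  split; last exact: admissible_beta_diagram.
  split; first exact: beta_diagramP.
  by move=> D /verbose_diagram_beta.
move=> S admS; pose b := column_birth S.
pose X := [set w | exhaustive (fun i j => L i j w)].
pose Y := [set w | PD w `&` square n = [set` S]].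
pose Z := [set w | forall s, (s < n)%N -> beta (fun i j => L i j w) s = b s].
have mX : measurable X := measurable_exhaustive HL.
have [mZ PZ] := prob_cylinder HL (@cylinder_beta F n b).
have YX : Y `&` X = Z `&` X.
  apply/seteqP; split=> w [Yw Xw]; split=> //; move: Yw;
  by rewrite /Y /Z /PD /= exhaustive_verbose_diagram// =>
    /(beta_diagram_columns admS).
(* Off [X] the diagram is the default [set0], so this part of [Y] is the whole complement of [X] or
   empty; hence [Y] is measurable even if [P] is not complete. *)
have YnX : Y `\` X = if `[< [set` S] = set0 >] then ~` X else set0.
  case: asboolP => S0; apply/seteqP; split=> w //=.
  - by case.
  - move=> nXw; split=> //; rewrite /Y /PD /= nonexhaustive_verbose_diagram//.
    by rewrite set0I S0.
  - move=> [Yw nXw]; apply: S0; rewrite -Yw /PD nonexhaustive_verbose_diagram//.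
    by rewrite set0I.
have mY : measurable Y.
  rewrite -(setUIDK Y X) YX YnX; apply: measurableU; first exact: measurableI.
  by case: asboolP => // _; apply: measurableC.
split=> //.
have PnX : P (~` X) = 0%E.
  have /negligibleP := ae_exhaustive HL; apply; exact: measurableC.
have PI A : measurable A -> P A = P (A `&` X).
  move=> mA; transitivity (P (A `\` X) + P (A `&` X))%E; first exact: measureDI.
  have mAX : measurable (A `\` X) by apply: measurableD.
  suff -> : P (A `\` X) = 0%E by rewrite add0e.
  apply/eqP; rewrite -measure_le0 -PnX; apply: le_measure; rewrite ?inE//.
  exact: measurableC.
rewrite -/Y (PI Y)// YX -PI// [P Z]PZ; congr (_%:E).
have q0 : q != 0 by apply: lt0r_neq0; apply: lt_trans (q_gt1 F R).
rewrite avg_beta; last 2 first.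
- by move=> s _; apply: (column_birth_le admS).
- by move=> i s /andP[ilt _]; apply: (column_birth_inj admS).
rewrite prodf_div big_split /= -/q !prodrXr big_split /=.
rewrite -(card_columns admS) -(Sigma_columns admS) -(inversions_columns admS).
rewrite expfzDr// expfzDr// -!exprnP -exprnN exprD !mulrA.
congr (_ / q ^+ _).
by rewrite -bin2_sum big_ltn// big_add1 /= big_mkord add0n.
Qed.
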